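(* Let $K\ge2$ and $n\ge K^2+K-1$ be integers. Then the number $N^{\sim_{3/2}}_K(n)$ of $\sim_{3/2}$-classes in $\{\mathtt a,\mathtt b\}^n$ of cardinality $K$ is $$N^{\sim_{3/2}}_K(n)=\sum_{r=2}^{K}\bigl(\#\{\alpha\in\mathbb N:L_r(\alpha)=K\}+\#\{\beta\in\mathbb N_{>0}:R_r(\beta)=K\}\bigr).$$
   Context: $\mathbb N=\{0,1,2,\dots\}$ and $\mathbb N_{>0}=\mathbb N\setminus\{0\}$. For a word $w$ over $\{\mathtt a,\mathtt b\}$, $|w|_{\mathtt a}$ is the number of letters $\mathtt a$ and $\binom{w}{\mathtt{ab}}$ the number of occurrences of $\mathtt{ab}$ as a scattered subword. Set $\operatorname{strip}(w)=\lfloor\binom{w}{\mathtt{ab}}/|w|_{\mathtt a}\rfloor$ if $|w|_{\mathtt a}>0$, and $0$ if $|w|_{\mathtt a}=0$. For $u,w\in\{\mathtt a,\mathtt b\}^n$, $u\sim_{3/2}w$ iff $|u|_{\mathtt a}=|w|_{\mathtt a}$ and $\operatorname{strip}(u)=\operatorname{strip}(w)$. Let $p_{\le r}(\xi)$ be the number of partitions of $\xi$ with at most $r$ parts. For $r\ge2$, $\alpha\in\mathbb N$, $\beta\in\mathbb N_{>0}$ define $$L_r(\alpha)=\sum_{\xi=\alpha r}^{(\alpha+1)r-1}p_{\le r}(\xi),\qquad R_r(\beta)=\sum_{\xi=(\beta-1)r+1}^{\beta r}p_{\le r}(\xi).$$ *)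

(* Defs.v *)
From mathcomp Require Import all_boot finmap.
From mathcomp Require Import classical_sets cardinality.

Set Implicit Arguments.
Unset Strict Implicit.
Unset Printing Implicit Defensive.

(* The alphabet {a, b} is bool. *)
Notation letter := bool.
Definition letter_a : letter := true.
Definition letter_b : letter := false.

Definition count_a n (w : n.-tuple letter) : nat := count_mem letter_a w.

(* binom(w, ab): pairs of positions i < j carrying a and b respectively. *)
Definition binom_ab n (w : n.-tuple letter) : nat :=
  #|[set p : 'I_n * 'I_n | [&& p.1 < p.2,
      tnth w p.1 == letter_a & tnth w p.2 == letter_b]]|.

Definition strip n (w : n.-tuple letter) : nat :=
  if 0 < count_a w then binom_ab w %/ count_a w else 0.

Definition sim32 n : rel (n.-tuple letter) := fun u w =>
  (count_a u == count_a w) && (strip u == strip w).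

Definition sim32_classes n : {set {set n.-tuple letter}} :=
  equivalence_partition (@sim32 n) [set: n.-tuple letter].

(* N_K(n) for the relation ~_{3/2}. *)
Definition num_classes (K n : nat) : nat :=
  #|[set C in sim32_classes n | #|C| == K]|.

Definition is_partition (xi : nat) (s : seq nat) : bool :=
  [&& sorted geq s, all (ltn 0) s & sumn s == xi].

(* p_{<= r}(xi), summed over the exact number k <= r of parts; the parts of a
   partition of xi are at most xi, so ranging over 'I_xi.+1 loses nothing. *)
Definition part_le (r xi : nat) : nat :=
  \sum_(k < r.+1)
    #|[set t : k.-tuple 'I_xi.+1 | is_partition xi (map val t)]|.

Definition Lsum (r alpha : nat) : nat :=
  \sum_(alpha * r <= xi < alpha.+1 * r) part_le r xi.

(* Only meaningful for beta > 0. *)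
Definition Rsum (r beta : nat) : nat :=
  \sum_((beta - 1) * r + 1 <= xi < (beta * r).+1) part_le r xi.

Definition Lfiber (K r : nat) : set nat :=
  [set alpha | Lsum r alpha = K]%classic.

Definition Rfiber (K r : nat) : set nat :=
  [set beta | (0 < beta)%N /\ Rsum r beta = K]%classic.

(* The cardinality of a set of naturals; fset_set sends infinite sets to the
   empty one, so this is meaningful only together with finite_set A. *)
Definition card_natset (A : set nat) : nat := #|` fset_set A|.

(* Main.v *)
Require Import Defs.
From mathcomp Require Import all_boot finmap.
From mathcomp Require Import classical_sets cardinality.
From mathcomp Require Import zify.

(* A word with r letters a and s letters b is a partition inside the r x s box
   (each a contributes the number of b's to its right), of weight binom(w, ab).
   So the class with |w|_a = r and strip k, k < s, has as size the sum of the
   Gaussian coefficients box r s x over the r consecutive x in [kr, (k+1)r).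
   For r <= 1 or k >= s this is at most 1, and for k < s it is at least r, so
   only 2 <= r <= K matters, and then s >= K^2 - 1 is large.  If k is small, the
   bound s on the parts is void and the size is L_r(k); if s - k is small, the
   complement in the box gives R_r(s - k); in between the size exceeds K.  The
   two regimes are disjoint, and L_r(alpha) = K or R_r(beta) = K forces alpha or
   beta to be small. *)

(** * Recurrences and bounds for restricted partition counts *)

(* The number of partitions of x into at most r parts, all of them <= s; the
   index j is the largest part. *)
Fixpoint box (r s x : nat) : nat :=
  if r is r'.+1 then
    \sum_(j < s.+1) (if j <= x then box r' j (x - j) else 0)
  else x == 0.

Lemma boxS0 r x : box r.+1 0 x = box r 0 x.
Proof. by rewrite /= big_ord1 subn0. Qed.

(** Either no part equals [s.+1], or one such part is removed; this is the Pascal rule for Gaussian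
    coefficients. *)
Lemma boxSS r s x :
  box r.+1 s.+1 x =
  box r.+1 s x + (if s < x then box r s.+1 (x - s.+1) else 0).
Proof. by rewrite /= big_ord_recr. Qed.

Lemma box_s0 r x : box r 0 x = (x == 0).
Proof. by elim: r => // r <-; apply: boxS0. Qed.

Lemma box_le_parts r s x : box r s x <= box r.+1 s x.
Proof.
elim: r s x => [|r IHr] s x.
  by rewrite /= big_ord_recl subn0 leq_addr.
elim: s x => [|s IHs] x; first by rewrite (boxS0 r.+1).
rewrite (boxSS r) (boxSS r.+1) leq_add ?IHs //.
by case: ifP => // _; apply: IHr.
Qed.

Lemma box_add_full_part r s x : box r s x <= box r.+1 s (x + s).
Proof.
case: s => [|s]; first by rewrite addn0 boxS0.
by rewrite boxSS addnK ifT ?leq_addl.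
Qed.

Lemma box_large r s x : r * s < x -> box r s x = 0.
Proof.
elim: r s x => [|r IHr] s x; first by case: x.
move=> lt_x; rewrite /= big1 // => j _; case: ifP => // le_jx.
by apply: IHr; have := ltn_ord j; nia.
Qed.

Lemma box_widen r s x : x <= s -> box r s x = box r x x.
Proof.
elim: r s x => // r IHr s x; elim: s => [|s IHs]; first by case: x.
rewrite leq_eqVlt => /predU1P[-> //|lt_xs].
by rewrite boxSS IHs ?ifF ?addn0 //; lia.
Qed.

Lemma box1 s x : box 1 s x = (x <= s).
Proof.
elim: s => [|s IHs]; first by rewrite box_s0; lia.
by rewrite boxSS IHs /=; case: ifP; lia.
Qed.

Lemma box2 s x :
  box 2 s x = if x <= s.*2 then (minn x (s.*2 - x))./2.+1 else 0.
Proof.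
elim: s => [|s IHs]; first by rewrite box_s0; case: x.
by rewrite boxSS IHs box1; do ?case: ifP; lia.
Qed.

(* A weak substitute for the unimodality of Gaussian coefficients: the case
   r = 2 propagates by adding either an empty part or a part equal to s. *)
Lemma box_lower_bound r s h x :
  1 < r -> h.*2 <= s -> h <= x -> x + h <= r * s -> h./2.+1 <= box r s x.
Proof.
move=> lt1r le_hs; case: r lt1r => [|[|r]] // _.
elim: r x => [|r IHr] x le_hx le_x.
  by rewrite box2 ifT; lia.
have [le_x'|lt_x] := leqP (x + h) (r.+2 * s).
  by apply: leq_trans (IHr x le_hx le_x') (box_le_parts _ _ _).
(* Here [x > 2s - h >= s + h] because [2h <= s], so a part [s] can be split off with at least [h]
   left. *)
have le_sx : s + h <= x by nia.
rewrite -(subnK (leq_trans (leq_addr h s) le_sx)).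
by apply: leq_trans (IHr _ _ _) (box_add_full_part _ _ _); nia.
Qed.

(** * Counting tuples by their first entry *)

Lemma card_tupleS (T : finType) n (P : seq T -> bool) :
  #|[set t : n.+1.-tuple T | P t]| =
  \sum_(x : T) #|[set t : n.-tuple T | P (x :: t)]|.
Proof.
rewrite -sum1dep_card.
rewrite (reindex (fun p : T * n.-tuple T => [tuple of p.1 :: p.2])) /=; last first.
  exists (fun t : n.+1.-tuple T => (thead t, [tuple of behead t])).
    by move=> [x t] _; congr pair; apply: val_inj.
  by move=> t _; rewrite -tuple_eta.
rewrite -(pair_big_dep xpredT (fun x (t : n.-tuple T) => P (x :: t))
  (fun _ _ => 1)) /=.
by apply: eq_bigr => x _; rewrite sum1dep_card.
Qed.

Lemma card_tuple0 (T : finType) (P : seq T -> bool) :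
  #|[set t : 0.-tuple T | P t]| = P [::].
Proof.
have [nP|nP] := boolP (P [::]).
  rewrite (eq_card (B := predT)) ?card_tuple // => t.
  by rewrite !inE tuple0 nP.
by apply: eq_card0 => t; rewrite !inE tuple0; apply/negbTE.
Qed.

(** * Partitions in a box *)

(* [path geq s] also bounds every part by s. *)
Definition parts_below (x s : nat) (p : seq nat) : bool :=
  [&& path geq s p, all (ltn 0) p & sumn p == x].

Lemma parts_below_cons x s j p :
  parts_below x s (j :: p) =
  [&& 0 < j <= s, j <= x & parts_below (x - j) j p].
Proof.
rewrite /parts_below /= /geq /=; case: (path _ _ _); case: (all _ _); lia.
Qed.

(** The type of the entries is fixed by [m], so that the induction may lower the bound [s] to the
    largest part without changing the tuples. *)
Lemma card_parts_below r m s x : s <= m ->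
  \sum_(k < r.+1)
    #|[set t : k.-tuple 'I_m.+1 | parts_below x s (map val t)]| = box r s x.
Proof.
elim: r s x => [|r IHr] s x le_sm.
  rewrite big_ord1 /= (card_tuple0 _ (fun t => parts_below x s (map val t))).
  by rewrite /parts_below /= eq_sym.
rewrite big_ord_recl /= (card_tuple0 _ (fun t => parts_below x s (map val t))).
transitivity ((x == 0) + \sum_(k < r.+1) \sum_(j < m.+1)
   if (0 < j <= s) && (j <= x) then
    #|[set t : k.-tuple 'I_m.+1 | parts_below (x - j) j (map val t)]| else 0).
  congr addn; first by rewrite /parts_below /= eq_sym.
  apply: eq_bigr => k _.
  rewrite /bump /= (card_tupleS _ _ (fun t => parts_below x s (map val t))).
  apply: eq_bigr => j _ /=; case: ifP => [/andP[js jx]|njsx].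
    by apply: eq_card => t; rewrite !inE parts_below_cons js jx.
  apply: eq_card0 => t; rewrite !inE parts_below_cons andbA.
  by rewrite njsx.
(* No partition has a first part 0, while the summand [j = 0] of [box] accounts for the empty
   partition, that is, for the term [x == 0] on the left. *)
rewrite exchange_big /= big_ord_recl /= [X in _ + (X + _)]big1 // add0n.
rewrite [RHS]big_ord_recl subn0 box_s0; congr addn.
rewrite (big_ord_widen _ (fun i => if i.+1 <= x then box r i.+1 (x - i.+1) else 0)
  le_sm) [RHS]big_mkcond /=.
apply: eq_bigr => j _; rewrite /bump /= add1n.
have [lt_js|] /= := ltnP j s; last by rewrite big1.
case: ifP => _; last by rewrite big1.
by rewrite IHr.
Qed.

Lemma part_leE r x : part_le r x = box r x x.
Proof.
rewrite -(card_parts_below r x x x (leqnn x)); apply: eq_bigr => k _.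
apply: eq_card => t; rewrite !inE /is_partition /parts_below.
congr andb; case: t => -[//|j p] /= _.
by rewrite /geq /= -ltnS ltn_ord.
Qed.

(** * Words *)

(** This recursive form of [binom_ab] permits induction on words without positions. *)
Fixpoint ab (w : seq letter) : nat :=
  if w is c :: w' then (if c then count_mem letter_b w' else 0) + ab w' else 0.

Lemma binom_abE n (w : n.-tuple letter) : binom_ab w = ab w.
Proof.
rewrite /binom_ab -sum1dep_card.
rewrite -(pair_big_dep xpredT (fun i j : 'I_n => [&& i < j,
  tnth w i == letter_a & tnth w j == letter_b]) (fun _ _ => 1)) /=.
elim: n w => [|n IHn] w; first by rewrite big_ord0 [w]tuple0.
case/tupleP: w => c w.
rewrite big_ord_recl /=; congr addn.
  rewrite big_mkcond big_ord_recl /= add0n.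
  under eq_bigr => i _ do rewrite tnth0 tnthS /=.
  case: c => /=; last by rewrite big1.
  rewrite -[in RHS](map_tnth_enum w) count_map -sum1_count big_enum_cond.
  by rewrite -big_mkcond.
rewrite -(IHn w); apply: eq_bigr => i _.
rewrite big_mkcond big_ord_recl /= add0n -big_mkcond /=.
by apply: eq_bigl => j; rewrite !tnthS.
Qed.

Lemma ab_rcons w c :
  ab (rcons w c) = ab w + (if c then 0 else count_mem letter_a w).
Proof.
elim: w => [|d w IHw] /=; first by rewrite if_same.
by rewrite IHw -cats1 count_cat /=; move: IHw; case: c d => -[] /=; lia.
Qed.

(** An a and a b of [w] stand in the order ab either in [w] or in its reversal, never in both. *)
Lemma ab_rev w :
  ab (rev w) + ab w = count_mem letter_a w * count_mem letter_b w.
Proof.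
elim: w => //= c w IHw; rewrite rev_cons ab_rcons count_rev.
by case: c => /=; nia.
Qed.

Lemma count_ab w : count_mem letter_a w + count_mem letter_b w = size w.
Proof. by elim: w => //= -[] w /=; lia. Qed.

(** Removing a leading a lowers [ab] by the number of b's, removing a leading b leaves it unchanged:
    this is the recurrence [boxSS]. *)
Lemma card_words r s x :
  #|[set w : (r + s).-tuple letter | (count_mem letter_a w == r) && (ab w == x)]|
  = box r s x.
Proof.
move En: (r + s) => n; elim: n r s x En => [|n IHn] r s x En.
  have [-> ->] : r = 0 /\ s = 0 by lia.
  by rewrite (card_tuple0 _ (fun w => (count_mem letter_a w == 0) && (ab w == x)))
     /= eq_sym.
rewrite (card_tupleS _ _ (fun w => (count_mem letter_a w == r) && (ab w == x))).
rewrite big_bool /=.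
case: r En => [|r] En.
  rewrite [X in X + _]eq_card0 => [|w]; last by rewrite !inE.
  by rewrite -[RHS]/(box 0 n x) -(IHn 0 n x).
have count_b (w : n.-tuple letter) : count_mem letter_a w = r ->
    count_mem letter_b w = s.
  by have := count_ab w; rewrite size_tuple; lia.
have -> : #|[set w : n.-tuple letter | (1 + count_mem letter_a w == r.+1)
    && (count_mem letter_b w + ab w == x)]| =
    if s <= x then box r s (x - s) else 0.
  rewrite -(IHn r s (x - s)); last by lia.
  case: ifP => sx.
    apply: eq_card => w; rewrite !inE add1n eqSS.
    by case: eqP => //= /count_b ->; lia.
  apply: eq_card0 => w; rewrite !inE add1n eqSS.
  by case: eqP => //= /count_b ->; lia.
case: s En count_b => [|s] En count_b.
  rewrite leq0n subn0 boxS0 [X in _ + X]eq_card0 ?addn0 // => w.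
  rewrite !inE; apply/negbTE; rewrite negb_and; apply/orP; left.
  by have := count_ab w; rewrite size_tuple /=; lia.
rewrite boxSS addnC -(IHn r.+1 s x); last by lia.
by congr addn; apply: eq_card => w; rewrite !inE.
Qed.

(** Reversal of words is a bijection that realises the complement in the box. *)
Lemma box_sym r s x : x <= r * s -> box r s x = box r s (r * s - x).
Proof.
move=> le_x; rewrite -!card_words.
have rev_inj : injective (fun w : (r + s).-tuple letter => [tuple of rev w]).
  by move=> u v /(congr1 val) /= /(inv_inj revK) /val_inj.
rewrite -(card_imset _ rev_inj); apply: eq_card => w; rewrite !inE.
apply/imsetP/idP => [[v + ->]|].
  rewrite inE => /andP[/eqP ca /eqP abv] /=.
  have := ab_rev v; have := count_ab v; rewrite size_tuple count_rev ca => cb.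
  have -> : count_mem letter_b v = s by lia.
  by rewrite eqxx /=; lia.
move=> /andP[/eqP ca /eqP abw]; exists [tuple of rev w]; last first.
  by apply: val_inj; rewrite /= revK.
have := ab_rev w; have := count_ab w; rewrite inE /= size_tuple count_rev ca => cb.
rewrite (addnI cb).
by rewrite eqxx /=; lia.
Qed.
(** * Sizes of the classes *)

Definition fiber_card (n r k : nat) : nat :=
  #|[set w : n.-tuple letter | (count_a w == r) && (strip w == k)]|.

Lemma count_a_le n (w : n.-tuple letter) : count_a w <= n.
Proof. by rewrite -[X in _ <= X](size_tuple w) count_size. Qed.

Lemma ab_le n (w : n.-tuple letter) : ab w <= count_a w * (n - count_a w).
Proof.
have := ab_rev w; have := count_ab w; rewrite size_tuple -/(count_a w) => ca.
have -> : n - count_a w = count_mem letter_b w by rewrite -[X in X - _]ca addKn.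
by move=> <-; apply: leq_addl.
Qed.

Lemma strip_le n (w : n.-tuple letter) : strip w <= n.
Proof.
rewrite /strip binom_abE; case: ifP => // a_gt0; have le_ab := ab_le _ w.
apply: leq_trans (leq_subr (count_a w) n).
by rewrite -[X in _ <= X](mulKn _ a_gt0) leq_div2r.
Qed.

(** The classes are the nonempty fibers of the pair ([count_a], [strip]). As [K > 0], fibers of size
    [K] are nonempty, so distinct pairs give distinct classes. *)
Lemma num_classesE K n : 0 < K ->
  num_classes K n = \sum_(r < n.+1) \sum_(k < n.+1) (fiber_card n r k == K).
Proof.
move=> K_gt0; pose fiber (v : 'I_n.+1 * 'I_n.+1) :=
  [set w : n.-tuple letter | (count_a w == v.1) && (strip w == v.2)].
rewrite pair_big /= -big_mkcond sum1dep_card.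
have fiber_inj : {in [set v | #|fiber v| == K] &, injective fiber}.
  move=> [r k] [r' k'] rkK _ eq_f; move: rkK; rewrite inE => /eqP cK.
  have /card_gt0P[w w_f] : 0 < #|fiber (r, k)| by rewrite cK.
  have := w_f; rewrite {}eq_f in w_f.
  move: w_f; rewrite !inE /= => /andP[/eqP -> /eqP ->] /andP[/eqP e1 /eqP e2].
  by congr pair; apply: val_inj.
rewrite -(card_in_imset fiber_inj); apply: eq_card => C; rewrite inE.
apply/andP/imsetP => [[/imsetP[u _ ->] CK]|[v]].
  have ltu := count_a_le _ u; have ltk := strip_le _ u.
  exists (Ordinal (n:=n.+1) (m:=count_a u) ltu, Ordinal (n:=n.+1) (m:=strip u) ltk).
    rewrite inE; apply: etrans CK; congr (_ == K).
    by apply: eq_card => w; rewrite !inE /sim32 eq_sym (eq_sym (strip u)).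
  by apply/setP => w; rewrite !inE /sim32 eq_sym (eq_sym (strip u)).
rewrite inE => vK ->; split=> //.
have /card_gt0P[u] : 0 < #|fiber v| by rewrite (eqP vK).
rewrite inE => /andP[/eqP u1 /eqP u2].
apply/imsetP; exists u => //; apply/setP => w.
by rewrite !inE /sim32 eq_sym (eq_sym (strip w)) u1 u2.
Qed.

Lemma card_nat_interval (T : finType) (P : pred T) (g : T -> nat) m n :
  #|[set w | P w && (m <= g w < n)]| =
  \sum_(m <= x < n) #|[set w | P w && (g w == x)]|.
Proof.
rewrite -sum1dep_card big_mkcondr.
under [RHS]eq_bigr => x _ do rewrite -sum1dep_card big_mkcondr.
rewrite exchange_big; apply: eq_bigr => w _ /=.
rewrite -big_mkcond sum1_count.
rewrite (eq_count (a2 := pred1 (g w))) => [|x]; last by rewrite /= eq_sym.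
by rewrite count_uniq_mem ?iota_uniq // mem_index_iota; case: ifP.
Qed.

Lemma fiber_cardE r s k : 0 < r ->
  fiber_card (r + s) r k = \sum_(k * r <= x < k.+1 * r) box r s x.
Proof.
move=> r_gt0; under eq_bigr => x _ do rewrite -card_words.
rewrite -(card_nat_interval _ (fun w => count_a w == r) (fun w => ab w)).
apply: eq_card => w; rewrite !inE /strip binom_abE.
by case: eqP => //= ->; rewrite r_gt0 -leq_divRL // -ltn_divLR // andbC
   ltnS eqn_leq.
Qed.

(** * Bounds on the class sizes and the two small regimes *)

Lemma leq_sum_nat_const c (F : nat -> nat) m n :
  (forall x, m <= x < n -> c <= F x) -> (n - m) * c <= \sum_(m <= x < n) F x.
Proof.
by move=> le_cF; rewrite -sum_nat_const_nat !big_nat; apply: leq_sum.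
Qed.

Lemma fiber_card_a0 n k : fiber_card n 0 k <= 1.
Proof.
(* The 1 is read as the number of words without a. *)
rewrite -[1]/(box 0 n 0) -card_words; apply: subset_leq_card.
apply/fintype.subsetP => w; rewrite !inE => /andP[a0 _].
by rewrite -/(count_a w) a0 -leqn0; have := ab_le _ w; rewrite (eqP a0).
Qed.

Lemma fiber_card_a1 s k : fiber_card (1 + s) 1 k <= 1.
Proof. by rewrite fiber_cardE // !muln1 big_nat1 box1 leq_b1. Qed.

(** Weights above [r * s] do not occur, so only the first weight [k * r] can contribute, and only if
    [k = s]. *)
Lemma fiber_card_top r s k : 0 < r -> s <= k -> fiber_card (r + s) r k <= 1.
Proof.
move=> r_gt0 le_sk; rewrite fiber_cardE // big_ltn; last by nia.
rewrite big_nat_cond big1 => [|x /andP[/andP[lt_x _] _]]; last first.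
  by apply: box_large; nia.
rewrite addn0; have [le_ks|lt_sk] := leqP k s; last by rewrite box_large //; nia.
have -> : k * r = r * s by nia.
by rewrite box_sym // subnn box_widen // box_s0.
Qed.

Lemma fiber_card_ge r s k : 1 < r -> k < s -> r <= fiber_card (r + s) r k.
Proof.
move=> r_gt1 lt_ks; rewrite fiber_cardE ?(ltnW r_gt1) //.
rewrite -[X in X <= _](_ : (k.+1 * r - k * r) * 1 = _); last first.
  by rewrite mulSn addnK muln1.
by apply: leq_sum_nat_const => x ?; apply: (box_lower_bound _ _ 0); nia.
Qed.

Lemma part_le_lower_bound r x : 1 < r -> x./2 < part_le r x.
Proof.
(* The bound on the parts is relaxed to [2x], so that [box_lower_bound] applies with [h = x]. *)
move=> r_gt1; rewrite part_leE -(box_widen r x.*2); last by lia.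
by apply: box_lower_bound => //; nia.
Qed.

Lemma Lsum_lower_bound r alpha :
  1 < r -> r * (alpha * r)./2.+1 <= Lsum r alpha.
Proof.
move=> r_gt1; rewrite -{1}(addnK (alpha * r) r) -mulSn.
apply: leq_sum_nat_const => x ?.
by apply: leq_trans (part_le_lower_bound _ x r_gt1); lia.
Qed.

Lemma Rsum_lower_bound r beta :
  1 < r -> 0 < beta -> r * ((beta - 1) * r + 1)./2.+1 <= Rsum r beta.
Proof.
move=> r_gt1 beta_gt0.
rewrite -[X in X * _ <= _](_ : (beta * r).+1 - ((beta - 1) * r + 1) = _); last by nia.
apply: leq_sum_nat_const => x ?.
by apply: leq_trans (part_le_lower_bound _ x r_gt1); lia.
Qed.

Lemma fiber_card_Lsum r s k :
  0 < r -> k.+1 * r <= s.+1 -> fiber_card (r + s) r k = Lsum r k.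
Proof.
move=> r_gt0 le_s; rewrite fiber_cardE //; apply: eq_big_nat => x ?.
by rewrite part_leE box_widen //; lia.
Qed.

(** The reflection [x -> r * s - x] carries the window of [s - beta] onto the range from
    [(beta - 1) * r + 1] to [beta * r], where all weights are at most [s]. *)
Lemma fiber_card_Rsum r s beta :
  0 < r -> 0 < beta <= s -> beta * r <= s ->
  fiber_card (r + s) r (s - beta) = Rsum r beta.
Proof.
move=> r_gt0 /andP[beta_gt0 le_beta] le_s; rewrite fiber_cardE // /Rsum.
have le_r : r <= beta * r by nia.
have E1 : (beta - 1) * r + r = beta * r by nia.
have E2 : (s - beta) * r + beta * r = r * s by nia.
rewrite -[X in \sum_(X <= _ < _) box _ _ _]add0n big_addn mulSn addnK.
rewrite -[X in _ = \sum_(X <= _ < _) _]add0n big_addn.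
rewrite [X in _ = \sum_(_ <= _ < X) _](_ : _ = r); last by lia.
rewrite [RHS]big_nat_rev; apply: eq_big_nat => x ?.
rewrite part_leE -(box_widen r s); last by lia.
by rewrite box_sym; [congr box|]; lia.
Qed.

Lemma Lsum_eq_small r s K alpha : 1 < r <= K -> K ^ 2 <= s.+1 ->
  Lsum r alpha = K -> alpha.+1 * r <= s.+1.
Proof.
move=> /andP[r_gt1 le_rK] le_s eqK.
have := Lsum_lower_bound _ alpha r_gt1; rewrite eqK => le_K.
(* Since [r >= 2], the lower bound exceeds [alpha * r]; then [(alpha + 1) * r < 2K <= K ^ 2]. *)
have lt_K : alpha * r < K by nia.
nia.
Qed.

Lemma Rsum_eq_small r s K beta : 1 < r <= K -> K ^ 2 <= s.+1 -> 0 < beta ->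
  Rsum r beta = K -> beta * r <= s.
Proof.
move=> /andP[r_gt1 le_rK] le_s beta_gt0 eqK.
have := Rsum_lower_bound _ _ r_gt1 beta_gt0; rewrite eqK => le_K.
have lt_K : (beta - 1) * r + 1 < K by nia.
nia.
Qed.

Lemma fiber_card_middle r s K k : 1 < r <= K -> K ^ 2 <= s.+1 -> k < s ->
  s.+1 < k.+1 * r -> s < (s - k) * r -> K < fiber_card (r + s) r k.
Proof.
move=> /andP[r_gt1 le_rK] le_s lt_ks ltL ltR.
(* For r = 2 the two small regimes cover all k. *)
have r_gt2 : 2 < r by nia.
have K2 : K * 3 <= s.+1 by nia.
have E : (s - k) * r + k * r = r * s by nia.
rewrite fiber_cardE; last by lia.
(* With [h = s./2], each of the [r >= 3] summands is at least [(s + 1) / 4], and [s + 1 >= 3K], so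
   the sum is at least [9K / 4]. *)
apply: (@leq_trans ((k.+1 * r - k * r) * s./2./2.+1)).
  rewrite mulSn addnK; nia.
apply: leq_sum_nat_const => x /andP[lex ltx].
by apply: box_lower_bound => //; lia.
Qed.

Lemma fiber_card_eqK r s K k : 1 < r <= K -> K ^ 2 <= s.+1 -> k < s ->
  (fiber_card (r + s) r k == K) = (Lsum r k == K) + (Rsum r (s - k) == K) :> nat.
Proof.
move=> rK le_s lt_ks; have /andP[r_gt1 le_rK] := rK.
have r_gt0 := ltnW r_gt1.
have sk : 0 < s - k <= s by lia.
have smallL := Lsum_eq_small _ _ _ k rK le_s.
have smallR := Rsum_eq_small _ _ _ (s - k) rK le_s.
have E : (s - k) * r + k * r = r * s by nia.
have [leL|ltL] := leqP (k.+1 * r) s.+1.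
  (* Both regimes at once would give [(s + 1) * r <= 2s + 1], impossible for [r >= 2]. *)
  rewrite fiber_card_Lsum // [Rsum _ _ == K]negbTE ?addn0 //.
  by apply/eqP => /smallR; nia.
rewrite [Lsum _ _ == K]negbTE ?add0n; last by apply/eqP => /smallL; lia.
have [leR|ltR] := leqP ((s - k) * r) s.
  by rewrite -(fiber_card_Rsum r s) // subKn // ltnW.
have := fiber_card_middle _ _ _ _ rK le_s lt_ks ltL ltR.
rewrite ltn_neqAle eq_sym => /andP[/negbTE -> _].
by case: eqP => // /smallR; lia.
Qed.

(** * Finite fibers and the final count *)

Lemma card_natset_pred (P : pred nat) (A : set nat) N :
  (forall x, A x <-> P x) -> (forall x, P x -> x < N) ->
  finite_set A /\ card_natset A = \sum_(0 <= x < N) P x.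
Proof.
move=> AP PN.
have finA : finite_set A.
  by apply: sub_finite_set (finite_II N) => x /AP /PN.
split=> //; rewrite /card_natset.
have -> : fset_set A = [fset x in [seq x <- iota 0 N | P x]]%fset.
  apply/fsetP => x; rewrite in_fset_set // !inE mem_filter mem_iota /=.
  apply/idP/andP => [/set_mem /AP Px|[/AP Ax _]]; last exact: mem_set.
  by rewrite Px add0n PN.
rewrite card_fseq undup_id ?filter_uniq ?iota_uniq // size_filter -sum1_count.
by rewrite big_mkcond /index_iota subn0; apply: eq_bigr => x _; case: (P x).
Qed.

Theorem theorem5 (K n : nat) (hK : 2 <= K) (hn : K ^ 2 + K - 1 <= n) :
  (forall r : nat, 2 <= r <= K ->
     finite_set (Lfiber K r) /\ finite_set (Rfiber K r)) /\
  num_classes K n =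
    \sum_(2 <= r < K.+1) (card_natset (Lfiber K r) + card_natset (Rfiber K r)).
Proof.
(* Here the hypothesis on [n] enters: [s = n - r] is the number of b's, and the worst case is
   [r = K]. *)
have le_s r : r <= K -> K ^ 2 <= (n - r).+1 by nia.
have LP r : 2 <= r <= K -> finite_set (Lfiber K r) /\
    card_natset (Lfiber K r) = \sum_(0 <= k < n - r) (Lsum r k == K).
  move=> rK; apply: card_natset_pred => [x|x /eqP xK].
    by split=> /eqP.
  have := Lsum_eq_small _ _ _ _ rK (le_s r _) xK; nia.
have RP r : 2 <= r <= K -> finite_set (Rfiber K r) /\
    card_natset (Rfiber K r) = \sum_(0 <= k < n - r) (Rsum r k.+1 == K).
  move=> rK.
  have [x|x /andP[x_gt0 /eqP xK]|fin ->] :=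
    card_natset_pred (fun x => (0 < x) && (Rsum r x == K))
      (Rfiber K r) (n - r).+1.
  - by split=> [[-> /eqP]|/andP[? /eqP]].
  - have := Rsum_eq_small _ _ _ _ rK (le_s r _) x_gt0 xK; nia.
  by rewrite big_nat_recl.
split=> [r rK|]; first by split; [apply: (LP r rK).1|apply: (RP r rK).1].
rewrite num_classesE; last by lia.
rewrite -(big_mkord xpredT (fun r => \sum_(k < n.+1) (fiber_card n r k == K))).
(* The values [r < 2] and then [r > K] are split off: there no class has size [K]. *)
rewrite (big_cat_nat (n := 2)) /=; [|by []|by nia].
rewrite [X in X + _]big_nat_cond [X in X + _]big1 ?add0n; last first.
  move=> r /andP[/andP[_ r_lt2] _]; apply: big1 => k _.
  suff : fiber_card n r k <= 1 by case: eqP => // ->; lia.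
  case: r r_lt2 => [|[|r]] // _; first exact: fiber_card_a0.
  by have := fiber_card_a1 (n - 1) k; rewrite subnKC //; nia.
rewrite (big_cat_nat (n := K.+1)) /=; [|by lia|by nia].
rewrite [X in _ + X]big_nat_cond [X in _ + X]big1 ?addn0; last first.
  move=> r /andP[/andP[lt_Kr le_rn] _]; apply: big1 => k _.
  case: eqP => // eqK.
  have [le_k|lt_k] := leqP (n - r) k.
    by have := fiber_card_top r _ _ (ltn_trans (ltnW hK) lt_Kr) le_k; rewrite subnKC // eqK; lia.
  by have := fiber_card_ge r _ _ (leq_ltn_trans (ltnW hK) lt_Kr) lt_k; rewrite subnKC // eqK; lia.
apply: eq_big_nat => r rK; rewrite ltnS in rK; have /andP[r_gt1 le_rK] := rK.
rewrite (LP r rK).2 (RP r rK).2.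
rewrite -(big_mkord xpredT (fun k => nat_of_bool (fiber_card n r k == K))).
rewrite (big_cat_nat (n := n - r)) /=; [|by []|by lia].
have le_rn : r <= n by nia.
rewrite [X in _ + X]big_nat_cond [X in _ + X]big1 ?addn0; last first.
  move=> k /andP[/andP[le_k _] _]; case: eqP => // eqK.
  by have := fiber_card_top r _ _ (ltnW r_gt1) le_k; rewrite subnKC // eqK; lia.
(* Reversing the sum over [beta = k + 1] pairs strip [k] with [beta = s - k]. *)
rewrite [X in _ = _ + X]big_nat_rev -big_split /=.
apply: eq_big_nat => k /andP[_ lt_k].
rewrite -{1}(subnKC le_rn) fiber_card_eqK //; last exact: le_s.
by rewrite add0n subnSK.
Qed.
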